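(* For all real $\alpha>-1$ and all $n\in\mathbb{N}$ with $n\ge 3$, the best constant $c_n(\alpha)$ in the Markov inequality $$\Vert p'\Vert_{w_\alpha}\le c_n(\alpha)\,\Vert p\Vert_{w_\alpha},\qquad p\in\mathcal{P}_n,$$ admits the estimates $$\frac{2\left(n+\frac{2\alpha}{3}\right)\left(n-\frac{\alpha+1}{6}\right)}{(\alpha+1)(\alpha+5)}<\big[c_n(\alpha)\big]^2<\frac{(n+1)\left(n+\frac{2(\alpha+1)}{5}\right)}{(\alpha+1)\big((\alpha+3)(\alpha+5)\big)^{1/3}},$$ where for the left-hand inequality it is additionally assumed that $n>(\alpha+1)/6$.
   Context: $\mathcal{P}_n$ is the set of algebraic polynomials of degree not exceeding $n$. For $\alpha>-1$, $w_\alpha(t)=t^\alpha e^{-t}$ on $(0,\infty)$ is the Laguerre weight and $\Vert f\Vert_{w_\alpha}=\left(\int_0^\infty t^\alpha e^{-t}|f(t)|^2\,dt\right)^{1/2}$. The best Markov constant is $c_n(\alpha)=\sup_{p\in\mathcal{P}_n,\ p\neq 0}\frac{\Vert p'\Vert_{w_\alpha}}{\Vert p\Vert_{w_\alpha}}$. *)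

(* Defs.v *)
From HB Require Import structures.
From mathcomp Require Export all_boot all_order all_algebra.
From mathcomp Require Export all_classical all_reals all_analysis.
Set Implicit Arguments.
Unset Strict Implicit.
Unset Printing Implicit Defensive.
Import Order.TTheory GRing.Theory Num.Theory.
Import numFieldNormedType.Exports.

Local Open Scope classical_set_scope.
Local Open Scope ring_scope.

Definition laguerre_weight (R : realType) (alpha t : R) : R :=
  t `^ alpha * expR (- t).

(* Extended-real valued, so that a divergent integral gives +oo. *)
Definition laguerre_norm (R : realType) (alpha : R) (f : R -> R) : \bar R :=
  ((\int[lebesgue_measure]_(t in `]0%R, +oo[)
      (laguerre_weight alpha t * `|f t| ^+ 2)%:E) `^ (2^-1)%R)%E.

(* [size p <= n.+1] says that p has degree at most n.
   The supremum is taken in the extended reals, so that finiteness of the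
   constant is not built into its definition. *)
Definition markov_const (R : realType) (n : nat) (alpha : R) : \bar R :=
  ereal_sup
    [set (laguerre_norm alpha (fun t => p^`().[t])
          / laguerre_norm alpha (fun t => p.[t]))%E
       | p in [set p : {poly R} | (size p <= n.+1)%N /\ p != 0]].

(* Main.v *)
From HB Require Import structures.
Require Import Defs.
From mathcomp Require Import all_boot all_order all_algebra.
From mathcomp Require Import all_classical all_reals all_analysis.
From mathcomp Require Import measurable_realfun ring lra.
Import Order.TTheory GRing.Theory Num.Theory.
Import numFieldNormedType.Exports.
Set Implicit Arguments.
Unset Strict Implicit.
Unset Printing Implicit Defensive.
Local Open Scope ring_scope.

(** Let h_k be the squared weighted norm of the k-th Laguerre polynomial
    l_k (parameter alpha), and a = alpha + 1.  The classical identity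
    l_k' = - (l_0 + ... + l_(k-1)) says that, in the orthonormal basis
    l_k / sqrt h_k, differentiation on polynomials of degree at most n is an
    explicit triangular matrix D.  Hence c_n^2 is the largest eigenvalue of
    the Gram matrix A = D D^T, whose entries are
    H_(min (k, m)) / sqrt (h_k h_m), with H_k = h_0 + ... + h_(k-1)
    = k h_k / a.

    For a positive semidefinite A the largest eigenvalue lies between
    tr A^3 / tr A^2 and (tr A^3)^(1/3); both bounds have short proofs that
    avoid eigenvalues ([form_cube_le_trace] and [trace_le_form_bound]).  The
    square roots cancel in the two traces, and since
    h_(k+1) / h_k = (k + a) / (k + 1) all the sums telescope: the traces are
    explicit polynomials in n over products of the factors a + i
    ([trace2_closed] and [trace3_closed]).  To leading order in n,
    tr A^2 ~ n^4 / (2 a^2 (a + 2)) and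
    tr A^3 ~ n^6 / (a^3 (a + 2) (a + 4)), which is where the two constants of
    the theorem come from; the strict inequalities become polynomial
    inequalities in n and a, and after the shift n = y + 3 every coefficient
    is nonnegative ([trace3_lt] and [trace_ratio_gt]).

    The analysis is confined to one fact: the moments
    m_k = int_0^oo t^(alpha + k) e^(-t) dt are finite, positive, and satisfy
    m_(k+1) = (k + a) m_k ([gamma_moment_rec]).  The linear functional L on
    polynomials with these moments then satisfies L(X p') = L((X - a) p), and
    this integration by parts rule alone yields the orthogonality of the l_k,
    because their differential equation is self-adjoint for L. *)

(** * Bounds on a quadratic form by traces of powers of its matrix *)

(** Lagrange's identity: the defect is a sum of squares. *)
Lemma cauchy_schwarz (R : realFieldType) (I : finType) (u v : I -> R) :
  (\sum_i u i * v i) ^+ 2 <= (\sum_i u i ^+ 2) * (\sum_i v i ^+ 2).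
Proof.
have lagrange : \sum_i \sum_j (u i * v j - u j * v i) ^+ 2 =
    2 * ((\sum_i u i ^+ 2) * (\sum_i v i ^+ 2) - (\sum_i u i * v i) ^+ 2).
  rewrite [X in _ - X]expr2 !big_distrlr/=.
  transitivity (\sum_i \sum_j (u i ^+ 2 * v j ^+ 2) +
     \sum_i \sum_j (u j ^+ 2 * v i ^+ 2) -
     2 * \sum_i \sum_j u i * v i * (u j * v j)).
    rewrite mulr_sumr -big_split -sumrB; apply: eq_bigr => i _ /=.
    rewrite mulr_sumr -big_split -sumrB; apply: eq_bigr => j _ /=; ring.
  by rewrite [X in _ + X - _]exchange_big/=; ring.
rewrite -subr_ge0 -(pmulr_rge0 _ (ltr0Sn R 1)) -lagrange.
by do 2![apply: sumr_ge0 => ? _]; exact: sqr_ge0.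
Qed.

Lemma mxtrace_mulT (R : comNzRingType) (m n : nat) (A B : 'M[R]_(m, n)) :
  \tr (A *m B^T) = \sum_i \sum_j A i j * B i j.
Proof.
by apply: eq_bigr => i _; rewrite !mxE; apply: eq_bigr => j _; rewrite !mxE.
Qed.

(** The squared Frobenius norm; on row vectors, the squared Euclidean norm. *)
Definition frob2 (R : comNzRingType) (m n : nat) (A : 'M[R]_(m, n)) : R :=
  \tr (A *m A^T).

Lemma frob2_ge0 (R : realFieldType) (m n : nat) (A : 'M[R]_(m, n)) : 0 <= frob2 A.
Proof.
rewrite /frob2 mxtrace_mulT; do 2![apply: sumr_ge0 => ? _].
by rewrite -expr2 sqr_ge0.
Qed.

Lemma frob2_rows (R : comNzRingType) (m n : nat) (A : 'M[R]_(m, n)) :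
  frob2 A = \sum_i frob2 (row i A).
Proof.
rewrite /frob2 mxtrace_mulT; apply: eq_bigr => i _.
by rewrite mxtrace_mulT big_ord1; apply: eq_bigr => j _; rewrite !mxE.
Qed.

Lemma mxtrace_cauchy_schwarz (R : realFieldType) (n : nat) (u v : 'rV[R]_n) :
  \tr (u *m v^T) ^+ 2 <= frob2 u * frob2 v.
Proof. by rewrite /frob2 !mxtrace_mulT !big_ord1; exact: cauchy_schwarz. Qed.

Lemma frob2_mul_le (R : realFieldType) (m n : nat) (u : 'rV[R]_m) (M : 'M[R]_(m, n)) :
  frob2 (u *m M) <= frob2 u * frob2 M.
Proof.
rewrite /frob2 !mxtrace_mulT !big_ord1 exchange_big mulr_sumr.
apply: ler_sum => j _; rewrite mxE -expr2; exact: cauchy_schwarz.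
Qed.

(** Every eigenvalue of a positive semidefinite matrix is at most the cube root
    of the trace of its cube.  With m_j = u A^j u^T, Cauchy-Schwarz gives
    m_1^2 <= m_0 m_2 and m_2^2 <= m_1 m_3, so m_1^3 <= m_0^2 m_3; and m_3 is
    at most m_0 times the squared Frobenius norm of A D, which is tr A^3. *)
Lemma form_cube_le_trace (R : realFieldType) (m n : nat) (D : 'M[R]_(m, n))
    (u : 'rV[R]_m) (A := D *m D^T) :
  frob2 (u *m D) ^+ 3 <= frob2 u ^+ 3 * \tr (A *m A *m A).
Proof.
(* A is made opaque so that rewriting under transposes does not unfold it. *)
have AE : A = D *m D^T by [].
have AT : A^T = A by rewrite AE trmx_mul trmxK.
clearbody A.
have trA3 : \tr (A *m A *m A) = frob2 (A *m D).
  by rewrite /frob2 trmx_mul AT mulmxA -(mulmxA A D) -AE.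
have e1 : frob2 (u *m D) = \tr (u *m (u *m A)^T).
  by rewrite /frob2 !trmx_mul AT AE !mulmxA.
have e2 : frob2 (u *m A) = \tr (u *m D *m (u *m A *m D)^T).
  by rewrite /frob2 !trmx_mul AT AE !mulmxA.
have cs1 := mxtrace_cauchy_schwarz u (u *m A); rewrite -e1 in cs1.
have cs2 := mxtrace_cauchy_schwarz (u *m D) (u *m A *m D); rewrite -e2 in cs2.
have le3 := frob2_mul_le u (A *m D); rewrite mulmxA -trA3 in le3.
have := frob2_ge0 (A *m D); rewrite -trA3.
move: cs1 cs2 le3 (frob2_ge0 (u *m D)) (frob2_ge0 u) => {e1 e2}.
move: (frob2 u) (frob2 (u *m D)) (frob2 (u *m A)) (frob2 (u *m A *m D)) (\tr _).
move=> m0 m1 m2 m3 T cs1 cs2 le3 m1_ge0 m0_ge0 T_ge0.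
have [->|m1_neq0] := eqVneq m1 0.
  by rewrite expr0n/= mulr_ge0 ?exprn_ge0.
have m1_gt0 : 0 < m1 by rewrite lt_neqAle eq_sym m1_neq0.
rewrite -(ler_pM2r m1_gt0) -exprSr.
have -> : m1 ^+ 4 = (m1 ^+ 2) ^+ 2 by ring.
apply: (@le_trans _ _ ((m0 * m2) ^+ 2)).
  by rewrite ler_sqr ?nnegrE ?(le_trans _ cs1) ?sqr_ge0.
rewrite exprMn; apply: (@le_trans _ _ (m0 ^+ 2 * (m1 * m3))).
  by rewrite ler_wpM2l// sqr_ge0.
have -> : m0 ^+ 3 * T * m1 = m0 ^+ 2 * (m1 * (m0 * T)) by ring.
by rewrite !ler_wpM2l// sqr_ge0.
Qed.

(** tr A^3 is the sum of the quadratic form of A over the rows of A, and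
    tr A^2 is the sum of the squared norms of these rows. *)
Lemma trace_le_form_bound (R : realFieldType) (m n : nat) (D : 'M[R]_(m, n)) (c : R)
    (A := D *m D^T) :
  (forall u : 'rV_m, frob2 (u *m D) <= c * frob2 u) ->
  \tr (A *m A *m A) <= c * \tr (A *m A).
Proof.
move=> cD; have AE : A = D *m D^T by [].
have AT : A^T = A by rewrite AE trmx_mul trmxK.
clearbody A.
have -> : \tr (A *m A *m A) = frob2 (A *m D).
  by rewrite /frob2 trmx_mul AT mulmxA -(mulmxA A D) -AE.
have -> : \tr (A *m A) = frob2 A by rewrite /frob2 AT.
rewrite !(frob2_rows A) frob2_rows mulr_sumr; apply: ler_sum => i _.
by rewrite row_mul cD.
Qed.

(** * Laguerre polynomials *)

(** The parameter is a = alpha + 1.  The recursion is the raising relation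
    (k + 1) l_(k+1) = X l_k' + (k + a - X) l_k, chosen over the three-term
    recurrence because the derivative rule and the differential equation then
    follow from each other in a single induction. *)
Fixpoint laguerre (R : numFieldType) (a : R) (k : nat) : {poly R} :=
  if k is j.+1 then
    (j.+1%:R^-1)%:P * ('X * (laguerre a j)^`() + (j%:R%:P + a%:P - 'X) * laguerre a j)
  else 1.

Definition laguerre_ode (R : numFieldType) (a : R) (k : nat) (p : {poly R}) : Prop :=
  'X * p^`()^`() + (a%:P - 'X) * p^`() + k%:R%:P * p = 0.

Section Laguerre.
Variables (R : numFieldType) (a : R).
Notation l := (laguerre a).

Lemma laguerre_raise k :
  (k.+1%:R)%:P * l k.+1 = 'X * (l k)^`() + (k%:R%:P + a%:P - 'X) * l k.
Proof. by rewrite [l k.+1]/= mulrA -polyCM mulfV ?mul1r ?pnatr_eq0. Qed.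

Lemma laguerre0 : l 0 = 1. Proof. by []. Qed.

Arguments laguerre : simpl never.

(** Differentiating the raising relation and eliminating p'' with the equation
    of p gives q' = p' - p; differentiating the resulting lowering relation
    X q' = (k + 1) q - (k + a) p gives the equation of q. *)
Lemma laguerre_step k (p q : {poly R}) : laguerre_ode a k p ->
  (k.+1%:R)%:P * q = 'X * p^`() + (k%:R%:P + a%:P - 'X) * p ->
  q^`() = p^`() - p /\ laguerre_ode a k.+1 q.
Proof.
rewrite /laguerre_ode -natr1 polyCD polyC1 => ode raise.
have dq : q^`() = p^`() - p.
  have kI : injective ( *%R (k.+1%:R%:P : {poly R})).
    by apply: mulfI; rewrite polyC_eq0 pnatr_eq0.
  apply: kI; rewrite -natr1 polyCD polyC1.
  have := congr1 (@deriv R) raise.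
  rewrite !(derivM, derivD, derivN, derivC, derivX) !(addr0, add0r, mul0r) => ->.
  by apply/subr0_eq; rewrite -[RHS]ode; ring.
split=> //.
have lower : 'X * q^`() = (k%:R%:P + 1) * q - (k%:R%:P + a%:P) * p.
  by rewrite raise dq; ring.
have := congr1 (@deriv R) lower.
rewrite !(derivM, derivD, derivN, derivC, derivX) !(addr0, add0r, mul0r, mul1r).
move=> /(canRL (addKr _)) ->; rewrite mulrBl lower dq; ring.
Qed.

Lemma laguerre_odeP k : laguerre_ode a k (l k).
Proof.
elim: k => [|k IH]; last by have [] := laguerre_step IH (laguerre_raise k).
by rewrite /laguerre_ode laguerre0 derivC deriv0; ring.
Qed.

Lemma laguerre_derivS k : (l k.+1)^`() = (l k)^`() - l k.
Proof. by have [] := laguerre_step (laguerre_odeP k) (laguerre_raise k). Qed.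

Lemma laguerre_deriv k : (l k)^`() = - \sum_(j < k) l j.
Proof.
elim: k => [|k IH]; first by rewrite laguerre0 derivC big_ord0 oppr0.
by rewrite laguerre_derivS IH big_ord_recr/= opprD.
Qed.

Lemma laguerre_lower k :
  'X * (l k.+1)^`() = k.+1%:R%:P * l k.+1 - (k%:R%:P + a%:P) * l k.
Proof. by rewrite laguerre_raise laguerre_derivS; ring. Qed.

Lemma size_coef_laguerre k : (size (l k) <= k.+1)%N /\ (l k)`_k != 0.
Proof.
elim: k => [|k [szk lk]]; first by rewrite laguerre0 size_poly1 coef1 oner_neq0.
have coefS j : k.+1%:R * (l k.+1)`_j.+1 =
    (j.+1%:R + k%:R + a) * (l k)`_j.+1 - (l k)`_j.
  rewrite -coefCM laguerre_raise coefD coefXM/= coef_deriv mulrBl coefB coefXM/=.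
  by rewrite -polyCD coefCM -mulr_natr; ring.
have k0 : k.+1%:R != 0 :> R by rewrite pnatr_eq0.
split.
  apply/leq_sizeP => -[//|j] kj; apply: (mulfI k0).
  have lk0 i : (k < i)%N -> (l k)`_i = 0 by move/leq_sizeP: szk; exact.
  by rewrite coefS !lk0 ?mulr0 ?subrr// ltnW.
apply: contraNneq lk => lk0; have := coefS k.
by rewrite lk0 (leq_sizeP _ _ szk)// !mulr0 sub0r => /eqP; rewrite eq_sym oppr_eq0.
Qed.

Lemma laguerre_span n (p : {poly R}) : (size p <= n)%N ->
  exists c : 'I_n -> R, p = \sum_k c k *: l k.
Proof.
elim: n p => [|n IH] p sz.
  by exists (fun=> 0); rewrite big_ord0; apply/eqP; rewrite -size_poly_leq0.
have [szn ln] := size_coef_laguerre n.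
have [|c pE] := IH (p - (p`_n / (l n)`_n) *: l n).
  apply/leq_sizeP => j; rewrite coefB coefZ leq_eqVlt => /predU1P[<-|nj].
    by rewrite divfK// subrr.
  by rewrite (leq_sizeP _ _ sz j)// (leq_sizeP _ _ szn j)// mulr0 subr0.
(* the coefficient of X^n determines that of l_n *)
exists (fun k => if unlift ord_max k is Some j then c j else p`_n / (l n)`_n).
rewrite big_ord_recr/= unlift_none -[LHS](subrK ((p`_n / (l n)`_n) *: l n)) pE.
congr (_ + _); apply: eq_bigr => j _.
rewrite (_ : widen_ord _ _ = lift ord_max j) ?liftK//; apply: val_inj.
by rewrite /= /bump leqNgt ltn_ord.
Qed.

Variable L : {scalar {poly R}}.
Hypothesis L_ibp : forall p, L ('X * p^`()) = L (('X - a%:P) * p).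

(** The operator p |-> - (X p'' + (a - X) p') has l_k as eigenvector for the
    eigenvalue k, and integration by parts turns its bilinear form into the
    symmetric expression on the right. *)
Lemma laguerre_selfadjoint k (q : {poly R}) :
  k%:R * L (l k * q) = L ('X * ((l k)^`() * q^`())).
Proof.
have := L_ibp ((l k)^`() * q); rewrite derivM => ibp.
have -> : k%:R * L (l k * q) = L (k%:R%:P * l k * q).
  by rewrite -mulrA mul_polyC linearZ.
have -> : k%:R%:P * l k * q =
    ('X - a%:P) * ((l k)^`() * q) - 'X * ((l k)^`()^`() * q).
  apply/subr0_eq; rewrite -[RHS](mul0r q) -(laguerre_odeP k); ring.
by rewrite linearB/= -ibp mulrDr linearD/= addrAC subrr add0r.
Qed.

(** Eigenvectors of a self-adjoint operator for distinct eigenvalues. *)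
Lemma laguerre_orthogonal j k : j != k -> L (l j * l k) = 0.
Proof.
move=> jk; have := laguerre_selfadjoint j (l k).
rewrite [(l j)^`() * _]mulrC -laguerre_selfadjoint [l k * _]mulrC.
move=> /eqP; rewrite -subr_eq0 -mulrBl mulf_eq0 subr_eq0 eqr_nat (negbTE jk).
by move/eqP.
Qed.

(** Both sides are L(X q' q') for q = l_(k+1): rewrite X q' by the lowering
    relation; in q' = - (l_0 + ... + l_k) only the term l_k is not orthogonal
    to the result. *)
Lemma laguerre_norm_step k : k.+1%:R * L (l k.+1 * l k.+1) = (k%:R + a) * L (l k * l k).
Proof.
have orth (i : nat) : (k <= i)%N -> L ((\sum_(j < k) l j) * l i) = 0.
  move=> ki; rewrite mulr_suml linear_sum big1// => j _.
  by apply: laguerre_orthogonal; rewrite neq_ltn (leq_trans (ltn_ord j)).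
have dl : (l k.+1)^`() = - (\sum_(j < k) l j) - l k.
  by rewrite laguerre_deriv big_ord_recr/= opprD.
rewrite laguerre_selfadjoint mulrA laguerre_lower -polyCD dl.
rewrite (_ : _ * _ = k.+1%:R *: (- ((\sum_(j < k) l j) * l k.+1) - l k * l k.+1) +
  (k%:R + a) *: ((\sum_(j < k) l j) * l k + l k * l k)); last first.
  by rewrite -!mul_polyC; ring.
rewrite linearD !linearZ/= linearB linearN linearD/= !orth//.
by rewrite (@laguerre_orthogonal k k.+1) ?ltn_eqF//; ring.
Qed.

End Laguerre.

(** * Functionals given by moments *)

Definition moment_functional (R : nzRingType) (m : nat -> R) (p : {poly R}) : R :=
  \sum_(i < size p) p`_i * m i.

Lemma moment_functional_widen (R : nzRingType) (m : nat -> R) (p : {poly R}) (n : nat) :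
  (size p <= n)%N -> moment_functional m p = \sum_(i < n) p`_i * m i.
Proof.
move=> pn; rewrite /moment_functional (big_ord_widen n (fun i => p`_i * m i))//.
rewrite big_mkcond; apply: eq_bigr => i _; case: ltnP => // /leq_sizeP pi.
by rewrite pi// mul0r.
Qed.

Lemma moment_functional_is_scalar (R : nzRingType) (m : nat -> R) :
  scalar (moment_functional m).
Proof.
move=> c p q; pose n := maxn (size (c *: p + q)) (maxn (size p) (size q)).
rewrite !(@moment_functional_widen _ m _ n) ?leq_max ?leqnn ?orbT//.
rewrite mulr_sumr -big_split; apply: eq_bigr => i _ /=.
by rewrite coefD coefZ mulrDl mulrA.
Qed.

HB.instance Definition _ (R : nzRingType) (m : nat -> R) :=
  GRing.isLinear.Build R {poly R} R *%R (moment_functional m)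
    (moment_functional_is_scalar m).

(** On X^k the two sides are k m_k and m_(k+1) - a m_k. *)
Lemma moment_functional_ibp (R : comNzRingType) (a : R) (m : nat -> R) (p : {poly R}) :
  (forall k, m k.+1 = (k%:R + a) * m k) ->
  moment_functional m ('X * p^`()) = moment_functional m (('X - a%:P) * p).
Proof.
move=> mS; pose n := (size p).+1.
have sz_p : (size p <= n)%N by [].
have sz_X (q : {poly R}) k : (size q <= k)%N -> (size ('X * q)%R <= k.+1)%N.
  by move=> qk; rewrite mulrC (leq_trans (size_mul_leq _ _))// size_polyX addn2.
have sz_dp : (size ('X * p^`())%R <= n)%N.
  by rewrite sz_X// (leq_trans (size_poly _ _))// leq_pred.
clearbody n; rewrite mulrBl linearB/= mul_polyC linearZ/=.
rewrite (moment_functional_widen _ sz_dp) (moment_functional_widen _ sz_p).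
rewrite (moment_functional_widen _ (sz_X _ _ sz_p)) big_ord_recl coefXM mul0r add0r.
rewrite mulr_sumr -sumrB; apply: eq_bigr => i _; rewrite mS.
case: i => -[|i] _ /=; rewrite !coefXM/=.
  by ring.
by rewrite coef_deriv -mulr_natl; ring.
Qed.

(** * Closed forms of the traces *)

Lemma sum_sym2_recr (R : comNzRingType) (f : nat -> nat -> R) (n : nat) :
  (forall k l, f k l = f l k) ->
  \sum_(k < n.+1) \sum_(l < n.+1) f k l =
  \sum_(k < n) \sum_(l < n) f k l + 2 * (\sum_(k < n) f k n) + f n n.
Proof.
move=> fC; rewrite big_ord_recr/= big_ord_recr/=.
under eq_bigr do rewrite big_ord_recr/=.
rewrite big_split/= [X in _ + (X + _)](eq_bigr (fun k : 'I_n => f k n)) => [|k _//].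
ring.
Qed.

(** The triples with largest entry n are sorted by how many of their entries
    equal n; the factors 3 count the positions of the exceptional entry. *)
Lemma sum_sym3_recr (R : comNzRingType) (f : nat -> nat -> nat -> R) (n : nat) :
  (forall k l m, f k l m = f l k m) -> (forall k l m, f k l m = f k m l) ->
  \sum_(k < n.+1) \sum_(l < n.+1) \sum_(m < n.+1) f k l m =
  \sum_(k < n) \sum_(l < n) \sum_(m < n) f k l m
  + 3 * (\sum_(k < n) \sum_(l < n) f k l n) + 3 * (\sum_(k < n) f k n n) + f n n n.
Proof.
move=> fC1 fC2.
have slice k : \sum_(l < n.+1) \sum_(m < n.+1) f k l m =
    \sum_(l < n) \sum_(m < n) f k l m + 2 * (\sum_(l < n) f k l n) + f k n n.
  by apply: (@sum_sym2_recr _ (f k)).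
rewrite big_ord_recr/= slice; under eq_bigr do rewrite slice.
rewrite !big_split/= -mulr_sumr.
have -> : \sum_(l < n) \sum_(m < n) f n l m = \sum_(k < n) \sum_(l < n) f k l n.
  by do 2![apply: eq_bigr => ? _]; rewrite fC1 fC2.
have -> : \sum_(l < n) f n l n = \sum_(k < n) f k n n.
  by apply: eq_bigr => ? _; rewrite fC1.
ring.
Qed.

Section Traces.
Variables (R : realFieldType) (a : R).
Hypothesis a_gt0 : 0 < a.

(** The squared norms of the Laguerre polynomials, normalized to be 1 at
    index 0: Gamma (k + a) / (Gamma a * k!). *)
Definition laguerre_sqnorm (k : nat) : R := \prod_(j < k) ((j%:R + a) / j.+1%:R).
Notation h := laguerre_sqnorm.

Lemma laguerre_sqnorm_gt0 k : 0 < h k.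
Proof. by apply: prodr_gt0 => j _; rewrite divr_gt0// ltr_wpDl. Qed.

Lemma laguerre_sqnormS k : h k.+1 = h k * ((k%:R + a) / (k%:R + 1)).
Proof. by rewrite /h big_ord_recr/= natr1. Qed.

Local Lemma nat1_neq0 k : k%:R + 1 != 0 :> R.
Proof. by rewrite natr1 pnatr_eq0. Qed.
Local Lemma aD_neq0 (b : R) : 0 <= b -> a + b != 0.
Proof. by move=> b0; rewrite gt_eqF// ltr_pwDl. Qed.

Local Lemma laguerre_sqnorm_neq0 k : h k != 0.
Proof. by rewrite gt_eqF ?laguerre_sqnorm_gt0. Qed.
Local Lemma a_neq0 : a != 0. Proof. by rewrite gt_eqF. Qed.

Ltac field_pos := field; rewrite ?(nat1_neq0, laguerre_sqnorm_neq0, a_neq0, aD_neq0) //.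

Definition laguerre_sqnorm_sum (n : nat) : R := \sum_(j < n) h j.
Notation H := laguerre_sqnorm_sum.

(** tr A^2 and, below, tr A^3 for the Gram matrix A of differentiation on
    degrees at most n; see [trace2_gram] and [trace3_gram]. *)
Definition laguerre_trace2 (n : nat) : R :=
  \sum_(k < n.+1) \sum_(l < n.+1) H (minn k l) ^+ 2 / (h k * h l).

Definition laguerre_trace3 (n : nat) : R :=
  \sum_(k < n.+1) \sum_(l < n.+1) \sum_(m < n.+1)
    H (minn k l) * H (minn l m) * H (minn k m) / (h k * h l * h m).

Lemma laguerre_sqnorm_sumE n : H n = n%:R * h n / a.
Proof.
elim: n => [|n IH]; first by rewrite /H big_ord0 !mul0r.
rewrite /H big_ord_recr/= -/(H n) IH laguerre_sqnormS -natr1; field_pos.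
Qed.

(** In terms of falling factorials (k)_r, the sum over k < n of (k)_r h_k
    telescopes to h_n (n)_(r+1) / (a + r); here k^2 = (k)_2 + (k)_1. *)
Lemma sum_sqr_sqnorm n : \sum_(k < n) k%:R ^+ 2 * h k =
  h n * (n%:R * (n%:R - 1) / (a + 1) + n%:R * (n%:R - 1) * (n%:R - 2) / (a + 2)).
Proof.
elim: n => [|n IH]; first by rewrite big_ord0 !mul0r addr0 mulr0.
rewrite big_ord_recr/= IH laguerre_sqnormS -natr1; field_pos.
Qed.

(** Up to the factor 1 / (a^2 h_n), this is the contribution to tr A^3 of the
    triples (k, l, n) with k, l < n.  On the right, the term with the factor 2
    comes from the pairs k < l, that is from the sum of l (sum_(k < l) k^2 h_k),
    and the last three terms come from the diagonal, the sum of k^3 h_k. *)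
Lemma sum_minn_sqnorm n : \sum_(k < n) \sum_(l < n) (k%:R * l%:R * H (minn k l)) =
  h n / a *
  (2 * ((n%:R * (n%:R - 1) * (n%:R - 2) * (n%:R - 3) / (a + 3)
         + 2 * (n%:R * (n%:R - 1) * (n%:R - 2)) / (a + 2)) / (a + 1)
        + (n%:R * (n%:R - 1) * (n%:R - 2) * (n%:R - 3) * (n%:R - 4) / (a + 4)
           + 3 * (n%:R * (n%:R - 1) * (n%:R - 2) * (n%:R - 3)) / (a + 3)) / (a + 2))
   + n%:R * (n%:R - 1) * (n%:R - 2) * (n%:R - 3) / (a + 3)
   + 3 * (n%:R * (n%:R - 1) * (n%:R - 2)) / (a + 2)
   + n%:R * (n%:R - 1) / (a + 1)).
Proof.
elim: n => [|n IH]; first by rewrite big_ord0; field_pos.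
rewrite (@sum_sym2_recr _ (fun k l => k%:R * l%:R * H (minn k l))); last first.
  by move=> k l; rewrite minnC [k%:R * _]mulrC.
rewrite IH (_ : \sum_(k < n) _ = n%:R / a * \sum_(k < n) k%:R ^+ 2 * h k); last first.
  rewrite mulr_sumr; apply: eq_bigr => k _.
  by rewrite (minn_idPl (ltnW (ltn_ord k))) laguerre_sqnorm_sumE; field_pos.
rewrite sum_sqr_sqnorm minnn laguerre_sqnorm_sumE laguerre_sqnormS -natr1; field_pos.
Qed.

Lemma trace2_closed n (x : R := n%:R) :
  a ^+ 2 * (a + 1) * (a + 2) * laguerre_trace2 n =
  ((3 * a + 3) * x ^+ 4
   + (2 * a ^+ 2 + 4 * a + 6) * x ^+ 3
   + (3 * a ^+ 2 + 6 * a + 3) * x ^+ 2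
   + (a ^+ 2 + 5 * a) * x) / 6.
Proof.
have step m : \sum_(k < m.+1) \sum_(l < m.+1) H (minn k l) ^+ 2 / (h k * h l) =
    \sum_(k < m) \sum_(l < m) H (minn k l) ^+ 2 / (h k * h l) +
    (2 * (m%:R * (m%:R - 1) / (a + 1) + m%:R * (m%:R - 1) * (m%:R - 2) / (a + 2))
     + m%:R ^+ 2) / a ^+ 2.
  rewrite (@sum_sym2_recr _ (fun k l => H (minn k l) ^+ 2 / (h k * h l))); last first.
    by move=> k l; rewrite minnC [h k * _]mulrC.
  rewrite [X in 2 * X](_ : _ = (a ^+ 2 * h m)^-1 * \sum_(k < m) k%:R ^+ 2 * h k); last first.
    rewrite mulr_sumr; apply: eq_bigr => k _.
    by rewrite (minn_idPl (ltnW (ltn_ord k))) laguerre_sqnorm_sumE; field_pos.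
  rewrite sum_sqr_sqnorm minnn laguerre_sqnorm_sumE; field_pos.
rewrite {}/x /laguerre_trace2; elim: n => [|n IH].
  by rewrite step !big_ord0; field_pos.
by rewrite step [LHS]mulrDr IH -natr1; field_pos.
Qed.

Lemma trace3_closed n (x : R := n%:R) :
  a ^+ 3 * (a + 1) * (a + 2) * (a + 3) * (a + 4) * laguerre_trace3 n =
  ((20 * a ^+ 2 + 80 * a + 60) * x ^+ 6
   + (24 * a ^+ 3 + 96 * a ^+ 2 + 180 * a + 180) * x ^+ 5
   + (5 * a ^+ 4 + 35 * a ^+ 3 + 210 * a ^+ 2 + 270 * a + 180) * x ^+ 4
   + (10 * a ^+ 4 + 70 * a ^+ 3 + 140 * a ^+ 2 + 320 * a + 60) * x ^+ 3
   + (5 * a ^+ 4 + 65 * a ^+ 3 + 120 * a ^+ 2 + 150 * a) * x ^+ 2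
   + (6 * a ^+ 3 + 114 * a ^+ 2) * x) / 20.
Proof.
pose f k l m := H (minn k l) * H (minn l m) * H (minn k m) / (h k * h l * h m).
have fC1 k l m : f k l m = f l k m.
  by rewrite /f (minnC l k) (mulrC (h l)); congr (_ * _); ring.
have fC2 k l m : f k l m = f k m l.
  by rewrite /f (minnC m l) (mulrAC (h k)); congr (_ * _); ring.
have step j : \sum_(k < j.+1) \sum_(l < j.+1) \sum_(m < j.+1) f k l m =
    \sum_(k < j) \sum_(l < j) \sum_(m < j) f k l m
    + 3 * ((a ^+ 2 * h j)^-1 * \sum_(k < j) \sum_(l < j) (k%:R * l%:R * H (minn k l)))
    + 3 * (j%:R / (a ^+ 3 * h j) * \sum_(k < j) k%:R ^+ 2 * h k) + j%:R ^+ 3 / a ^+ 3.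
  rewrite (sum_sym3_recr _ fC1 fC2) !mulr_sumr.
  congr (_ + _ + _ + _).
  - apply: eq_bigr => k _; rewrite !mulr_sumr; apply: eq_bigr => l _.
    rewrite /f (minn_idPl (ltnW (ltn_ord k))) (minn_idPl (ltnW (ltn_ord l))).
    by rewrite (laguerre_sqnorm_sumE k) (laguerre_sqnorm_sumE l); field_pos.
  - apply: eq_bigr => k _.
    by rewrite /f minnn (minn_idPl (ltnW (ltn_ord k))) !laguerre_sqnorm_sumE; field_pos.
  - by rewrite /f minnn laguerre_sqnorm_sumE; field_pos.
rewrite {}/x /laguerre_trace3; elim: n => [|n IH].
  by rewrite step !big_ord0; field_pos.
by rewrite step -!addrA [LHS]mulrDr IH sum_minn_sqnorm sum_sqr_sqnorm -natr1; field_pos.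
Qed.
End Traces.

Lemma laguerre_trace2_gt0 (R : realFieldType) (a : R) (n : nat) :
  0 < a -> (0 < n)%N -> 0 < laguerre_trace2 a n.
Proof.
move=> a0; rewrite -(ltr0n R) => n0.
have D0 : 0 < a ^+ 2 * (a + 1) * (a + 2) by rewrite !mulr_gt0 ?exprn_gt0 ?ltr_wpDr.
rewrite -(pmulr_rgt0 _ D0) trace2_closed// divr_gt0//.
by rewrite !(addr_gt0, mulr_gt0, exprn_gt0).
Qed.

(** Clearing denominators leaves a polynomial in y = n - 3 and a whose
    coefficients are all nonnegative, so it suffices to supply the monomials. *)
Lemma trace3_lt (R : realFieldType) (a : R) (n : nat) : 0 < a -> (3 <= n)%N ->
  a ^+ 3 * (a + 2) * (a + 4) * laguerre_trace3 a n <
  ((n%:R + 1) * (n%:R + 2 * a / 5)) ^+ 3.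
Proof.
move=> a0 n3; have a13 : 0 < (a + 1) * (a + 3) by rewrite mulr_gt0 ?ltr_wpDr.
rewrite -(ltr_pM2r a13); set T := laguerre_trace3 _ _.
rewrite (_ : _ * T * _ = a ^+ 3 * (a + 1) * (a + 2) * (a + 3) * (a + 4) * T); last by ring.
rewrite trace3_closed// -subr_gt0 -(subnK n3) natrD.
have y0 : 0 <= (n - 3)%:R :> R by [].
move: ((n - 3)%:R) y0 => y y0.
have m i j : 0 <= a ^+ i * y ^+ j by rewrite mulr_ge0 ?exprn_ge0// ltW.
move: (m 2 5) (m 1 5) (m 4 4) (m 3 4) (m 2 4) (m 1 4)
  (m 5 3) (m 4 3) (m 3 3) (m 2 3) (m 1 3) (m 5 2)
  (m 4 2) (m 3 2) (m 2 2) (m 1 2) (m 5 1) (m 4 1)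
  (m 3 1) (m 2 1) (m 1 1) (m 5 0) (m 4 0) (m 3 0)
  (m 2 0) => *.
lra.
Qed.

(** The same positivity of coefficients in y = n - 3 and a. *)
Lemma trace_ratio_gt (R : realFieldType) (a : R) (n : nat) : 0 < a -> (3 <= n)%N ->
  2 * (n%:R + 2 * (a - 1) / 3) * (n%:R - a / 6) * laguerre_trace2 a n <
  a * (a + 4) * laguerre_trace3 a n.
Proof.
move=> a0 n3.
have D0 : 0 < a ^+ 2 * (a + 1) * (a + 2) * (a + 3).
  by rewrite !mulr_gt0 ?exprn_gt0 ?ltr_wpDr.
rewrite -(ltr_pM2r D0); set T2 := laguerre_trace2 _ _; set T3 := laguerre_trace3 _ _.
rewrite [ltLHS](_ : _ = 2 * (n%:R + 2 * (a - 1) / 3) * (n%:R - a / 6) * (a + 3) *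
  (a ^+ 2 * (a + 1) * (a + 2) * T2)); last by ring.
rewrite [ltRHS](_ : _ = a ^+ 3 * (a + 1) * (a + 2) * (a + 3) * (a + 4) * T3); last by ring.
rewrite trace3_closed// trace2_closed// -subr_gt0 -(subnK n3) natrD.
have y0 : 0 <= (n - 3)%:R :> R by [].
move: ((n - 3)%:R) y0 => y y0.
have m i j : 0 <= a ^+ i * y ^+ j by rewrite mulr_ge0 ?exprn_ge0// ltW.
move: (m 3 5) (m 2 5) (m 1 5) (m 0 5) (m 4 4) (m 3 4)
  (m 2 4) (m 1 4) (m 0 4) (m 5 3) (m 4 3) (m 3 3)
  (m 2 3) (m 1 3) (m 0 3) (m 5 2) (m 4 2) (m 3 2)
  (m 2 2) (m 1 2) (m 0 2) (m 5 1) (m 4 1) (m 3 1)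
  (m 2 1) (m 1 1) (m 0 1) (m 5 0) (m 4 0) (m 3 0)
  (m 2 0) => *.
lra.
Qed.

(** * Differentiation as a matrix in the Laguerre basis *)

Section Parseval.
Variables (R : realFieldType) (a : R) (L : {scalar {poly R}}).
Hypothesis a_gt0 : 0 < a.
Hypothesis L_ibp : forall p, L ('X * p^`()) = L (('X - a%:P) * p).
Notation l := (laguerre a).
Notation h := (laguerre_sqnorm a).

Lemma laguerre_orthonorm j k : L (l j * l k) = (j == k)%:R * h k * L 1.
Proof.
have [->|jk] := eqVneq j k; last by rewrite (laguerre_orthogonal L_ibp jk) !mul0r.
rewrite mul1r; elim: k => [|k IH]; last first.
  have k0 : k.+1%:R != 0 :> R by rewrite pnatr_eq0.
  apply: (mulfI k0); rewrite (laguerre_norm_step L_ibp) IH laguerre_sqnormS -natr1.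
  by field; rewrite natr1.
by rewrite laguerre0 mul1r /laguerre_sqnorm big_ord0 mul1r.
Qed.

Lemma laguerre_parseval n (c : 'I_n -> R) (p := \sum_(k < n) c k *: l k) :
  L (p * p) = L 1 * \sum_(k < n) h k * c k ^+ 2.
Proof.
rewrite /p mulr_suml linear_sum mulr_sumr; apply: eq_bigr => j _ /=.
rewrite mulr_sumr linear_sum (bigD1 j)//= big1 => [|k kj].
  by rewrite -scalerAl -scalerAr !linearZ/= laguerre_orthonorm eqxx mul1r addr0; ring.
rewrite -scalerAl -scalerAr !linearZ/= laguerre_orthonorm eq_sym -val_eqE/= in kj *.
by rewrite (negbTE kj) !mul0r !mulr0.
Qed.

Lemma laguerre_deriv_coef n (c : 'I_n -> R) :
  (\sum_(k < n) c k *: l k)^`() = \sum_(j < n) (- \sum_(k < n | (j < k)%N) c k) *: l j.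
Proof.
rewrite raddf_sum/=.
transitivity (\sum_(k < n) \sum_(j < n | (j < k)%N) - (c k *: l j)).
  apply: eq_bigr => k _; rewrite derivZ laguerre_deriv scalerN scaler_sumr sumrN.
  congr (- _); rewrite (big_ord_widen_cond n xpredT (fun j => c k *: l j)) 1?ltnW//.
rewrite (exchange_big_dep xpredT)//=; apply: eq_bigr => j _.
by rewrite scaleNr scaler_suml sumrN.
Qed.

End Parseval.

Section DerivMatrix.
Variables (R : rcfType) (a : R) (L : {scalar {poly R}}).
Hypothesis a_gt0 : 0 < a.
Hypothesis L_ibp : forall p, L ('X * p^`()) = L (('X - a%:P) * p).
Hypothesis L1_gt0 : 0 < L 1.
Notation l := (laguerre a).
Notation h := (laguerre_sqnorm a).
Notation s k := (Num.sqrt (h k)).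

(** Differentiation in the orthonormal basis, acting on row vectors, up to the
    sign - 1 common to all entries. *)
Definition deriv_mx (n : nat) : 'M[R]_n :=
  \matrix_(k, j) if (j < k)%N then s j / s k else 0.

Local Lemma sqr_s k : s k ^+ 2 = h k.
Proof. by rewrite sqr_sqrtr// ltW ?laguerre_sqnorm_gt0. Qed.

Local Lemma s_neq0 k : s k != 0.
Proof. by rewrite gt_eqF// sqrtr_gt0 laguerre_sqnorm_gt0. Qed.

Lemma frob2_rv n (u : 'rV[R]_n) : frob2 u = \sum_i u 0 i ^+ 2.
Proof. by rewrite /frob2 mxtrace_mulT big_ord1; apply: eq_bigr => i _; rewrite expr2. Qed.

Lemma laguerre_frob2 n (u : 'rV[R]_n) (p := \sum_(k < n) (u 0 k / s k) *: l k) :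
  L (p * p) = L 1 * frob2 u /\
  L (p^`() * p^`()) = L 1 * frob2 (u *m deriv_mx n).
Proof.
rewrite /p laguerre_deriv_coef !laguerre_parseval// !frob2_rv.
split; congr (_ * _); apply: eq_bigr => j _.
  by rewrite exprMn exprVn sqr_s mulrC divfK// gt_eqF ?laguerre_sqnorm_gt0.
rewrite -sqr_s -exprMn mulrN sqrrN; congr (_ ^+ 2).
rewrite mxE mulr_sumr [LHS]big_mkcond; apply: eq_bigr => k _; rewrite mxE.
by case: ifP => _; [field; exact: s_neq0|rewrite mulr0].
Qed.

Lemma deriv_gramE n (k m : 'I_n) :
  (deriv_mx n *m (deriv_mx n)^T) k m = laguerre_sqnorm_sum a (minn k m) / (s k * s m).
Proof.
rewrite mxE /laguerre_sqnorm_sum mulr_suml.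
rewrite (big_ord_widen n (fun j => h j / (s k * s m))); last first.
  by rewrite geq_min ltnW.
rewrite [RHS]big_mkcond; apply: eq_bigr => j _; rewrite !mxE leq_min.
case: ifP => _ /=; last by rewrite mul0r.
case: ifP => _ /=; last by rewrite mulr0.
by rewrite -[in RHS](sqr_s j); field; rewrite !s_neq0.
Qed.

Lemma trace2_gram n (A := deriv_mx n.+1 *m (deriv_mx n.+1)^T) :
  \tr (A *m A) = laguerre_trace2 a n.
Proof.
apply: eq_bigr => k _; rewrite mxE; apply: eq_bigr => m _.
rewrite !deriv_gramE minnC -[in RHS](sqr_s k) -[in RHS](sqr_s m).
by field; rewrite !s_neq0.
Qed.

Lemma trace3_gram n (A := deriv_mx n.+1 *m (deriv_mx n.+1)^T) :
  \tr (A *m A *m A) = laguerre_trace3 a n.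
Proof.
rewrite /laguerre_trace3; apply: eq_bigr => k _; rewrite mxE.
under eq_bigr => m _ do rewrite mxE mulr_suml.
rewrite exchange_big; apply: eq_bigr => j _; apply: eq_bigr => m _.
by rewrite !deriv_gramE (minnC m k) -[in RHS](sqr_s k) -[in RHS](sqr_s j)
  -[in RHS](sqr_s m); field; rewrite !s_neq0.
Qed.

Lemma laguerre_coord n (p : {poly R}) : (size p <= n)%N ->
  exists u : 'rV[R]_n, p = \sum_(k < n) (u 0 k / s k) *: l k.
Proof.
move=> /(laguerre_span a)[c pE]; exists (\row_k (c k * s k)); rewrite {1}pE.
by apply: eq_bigr => k _; rewrite mxE mulfK ?s_neq0.
Qed.

Lemma laguerre_sqr_gt0 (p : {poly R}) : p != 0 -> 0 < L (p * p).
Proof.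
move=> p0; have [u pE] := laguerre_coord (leqnn (size p)).
move: (size p) u pE => n u pE; have [+ _] := laguerre_frob2 u; rewrite -pE => ->.
rewrite lt_neqAle eq_sym mulr_ge0 ?frob2_ge0 ?ltW// andbT.
apply: contraNneq p0 => /eqP; rewrite mulf_eq0 gt_eqF//= frob2_rv.
rewrite psumr_eq0 => [/allP u0|k _]; last exact: sqr_ge0.
apply/eqP; rewrite pE big1// => k _.
have := u0 k; rewrite mem_index_enum sqrf_eq0 => /(_ isT)/eqP ->.
by rewrite mul0r scale0r.
Qed.

Lemma laguerre_deriv_cube_le n (p : {poly R}) : (size p <= n.+1)%N ->
  L (p^`() * p^`()) ^+ 3 <= L (p * p) ^+ 3 * laguerre_trace3 a n.
Proof.
move=> /laguerre_coord[u ->]; have [-> ->] := laguerre_frob2 u.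
rewrite !exprMn -[leRHS]mulrA ler_pM2l ?exprn_gt0// -trace3_gram.
exact: form_cube_le_trace.
Qed.

Lemma laguerre_trace_le n (c : R) :
  (forall p : {poly R}, (size p <= n.+1)%N -> L (p^`() * p^`()) <= c * L (p * p)) ->
  laguerre_trace3 a n <= c * laguerre_trace2 a n.
Proof.
move=> Lc; rewrite -trace3_gram -trace2_gram; apply: trace_le_form_bound => u.
have [Lp Ldp] := laguerre_frob2 u.
rewrite -(ler_pM2l L1_gt0) mulrCA -Lp -Ldp; apply: Lc.
apply: (leq_trans (size_sum _ _ _)); apply/bigmax_leqP => k _.
apply: (leq_trans (size_scale_leq _ _)).
by rewrite (leq_trans (size_coef_laguerre a k).1).
Qed.

End DerivMatrix.

(** * Moments of the Laguerre weight *)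

Section GammaMoments.
Local Open Scope classical_set_scope.

Lemma measurable_laguerre_weight (R : realType) (s : R) (D : set R) :
  measurable_fun D (fun t => (laguerre_weight s t)%:E).
Proof.
apply/measurable_EFinP.
apply: measurable_funTS; apply: measurable_funM; first exact: measurable_powR.
by apply: (measurableT_comp (@measurable_expR R)); exact: oppr_measurable.
Qed.

Lemma laguerre_weight_ge0 (R : realType) (s t : R) : 0 <= laguerre_weight s t.
Proof. by rewrite mulr_ge0 ?powR_ge0 ?expR_ge0. Qed.

(** Away from both endpoints, so that neither the singularity of t^(s - 1) at
    0 nor the unbounded range of integration interferes. *)
Lemma laguerre_weight_ibp (R : realType) (s x y : R) : 0 < s -> 0 < x -> x < y ->
  (\int[lebesgue_measure]_(t in `[x, y]) (laguerre_weight s t)%:E =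
   (laguerre_weight s x - laguerre_weight s y)%:E +
   s%:E * \int[lebesgue_measure]_(t in `[x, y]) (laguerre_weight (s - 1) t)%:E)%E.
Proof.
move=> s0 x0 xy.
have dE (t : R) : is_derive t 1 (fun u : R => - expR (- u)) (expR (- t)).
  by apply: is_derive_eq; rewrite /GRing.scale/= mulrN1 opprK.
have cexp : continuous (fun u : R => expR (- u)).
  move=> t; apply: differentiable_continuous; apply/derivable1_diffP.
  exact: ex_derive.
have pos (t : R) : x <= t -> 0 < t by exact: lt_le_trans.
have dP (p t : R) : x <= t -> derivable (fun u : R => u `^ p) t 1.
  by move=> xt; apply: derivable_powR; rewrite in_itv/= andbT pos.
have cP (p t : R) : x <= t -> {for t, continuous (fun u : R => u `^ p)}.
  by move=> /(dP p)/derivable1_diffP/differentiable_continuous.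
rewrite (@integration_by_parts R (fun t => t `^ s) (fun t => - expR (- t))
  (fun t => s * t `^ (s - 1)) (fun t => expR (- t)) x y xy).
- congr (_ + _)%E; first by rewrite /laguerre_weight; congr EFin; ring.
  rewrite -ge0_integralZl//=; last 3 first.
  + exact: measurable_laguerre_weight.
  + by move=> t _; rewrite lee_fin laguerre_weight_ge0.
  + by rewrite lee_fin ltW.
  rewrite -[RHS]oppeK; congr (- _)%E; rewrite -integral_ge0N; last first.
    by move=> t _; rewrite mule_ge0 ?lee_fin ?laguerre_weight_ge0 ?ltW.
  apply: eq_integral => t _.
  by rewrite /laguerre_weight -EFinM -EFinN; congr EFin; ring.
- apply: derivable_within_continuous => t; rewrite in_itv/= => /andP[xt _].
  by apply: derivableM => //; exact: dP.
- split.
  + by move=> t; rewrite in_itv/= => /andP[/ltW xt _]; exact: dP.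
  + by apply: cvg_at_right_filter; exact: cP.
  + by apply: cvg_at_left_filter; apply: cP; exact: ltW.
- move=> t; rewrite in_itv/= => /andP[/ltW xt _].
  by rewrite powR_derive1// in_itv/= andbT pos.
- exact: continuous_subspaceT.
- split.
  + by move=> t _; exact: ex_derive.
  + apply: cvg_at_right_filter; apply: cvgN; exact: cexp.
  + apply: cvg_at_left_filter; apply: cvgN; exact: cexp.
- by move=> t _; rewrite derive1E; exact: derive_val.
Qed.

(** Gamma (s + 1), possibly infinite. *)
Definition gamma_moment (R : realType) (s : R) : \bar R :=
  (\int[lebesgue_measure]_(t in `]0%R, +oo[) (laguerre_weight s t)%:E)%E.

(** The shift by 2 makes every interval of the exhaustion nondegenerate. *)
Definition exhausting_itv (R : realType) (k : nat) : set R := `[k.+2%:R^-1, k.+2%:R].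

Lemma bigcup_exhausting_itv (R : realType) :
  \bigcup_k @exhausting_itv R k = `]0%R, +oo[ :> set R.
Proof.
apply/seteqP; split => t.
  move=> [k _]; rewrite /exhausting_itv/= !in_itv/= andbT => /andP[+ _].
  by apply: lt_le_trans; rewrite invr_gt0.
rewrite /= in_itv/= andbT => t0.
have [k kt] : exists k : nat, t^-1 + t <= k%:R.
  by exists (Num.trunc (t^-1 + t)).+1; apply/ltW/truncnS_gt.
have kt' : t^-1 + t <= k.+2%:R by rewrite (le_trans kt)// ler_nat ltnW.
have it0 : 0 < t^-1 by rewrite invr_gt0.
exists k => //; rewrite /exhausting_itv/= in_itv/= -[t in X in X && _]invrK lef_pV2 ?posrE//.
by apply/andP; split; lra.
Qed.

Lemma gamma_moment_cvg (R : realType) (s : R) :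
  (\int[lebesgue_measure]_(t in @exhausting_itv R k) (laguerre_weight s t)%:E)%E
    @[k --> \oo] --> gamma_moment s.
Proof.
rewrite /gamma_moment -bigcup_exhausting_itv; apply: ge0_nondecreasing_set_cvg_integral.
- apply/nondecreasing_seqP => k; rewrite /exhausting_itv subsetEset.
  apply: subset_itv; rewrite bnd_simp ?ler_nat//.
  by rewrite lef_pV2 ?posrE// ler_nat.
- by move=> k; exact: measurable_itv.
- by move=> k; exact: measurable_laguerre_weight.
- by move=> k t _; rewrite lee_fin laguerre_weight_ge0.
Qed.

Lemma cvg_inv_nat2 (R : realType) : (k.+2%:R^-1 : R) @[k --> \oo] --> (0 : R).
Proof. by have := @cvg_harmonic R; rewrite -(cvg_shiftS (@harmonic R)). Qed.

Lemma laguerre_weight_cvg0 (R : realType) (s : R) : 0 < s ->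
  laguerre_weight s k.+2%:R^-1 @[k --> \oo] --> (0 : R).
Proof.
move=> s0.
have lim0 : (k.+2%:R^-1 : R) `^ s @[k --> \oo] --> (0 : R).
  have [+ _] := cvg_at_rightP (fun x : R => x `^ s) 0 0.
  by move=> /(_ (powR_cvg0 s0)) /(_ (fun k => k.+2%:R^-1)); apply; split;
    [move=> k; rewrite invr_gt0|exact: cvg_inv_nat2].
apply: (squeeze_cvgr _ (cvg_cst 0) lim0); apply: nearW => k.
by rewrite laguerre_weight_ge0/= ler_piMr ?powR_ge0 ?expR_le1 ?oppr_le0.
Qed.

(** Compare with y^N e^(-y) <= (N + 1)! / y for an integer N > s. *)
Lemma laguerre_weight_cvgy (R : realType) (s : R) :
  laguerre_weight s k.+2%:R @[k --> \oo] --> (0 : R).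
Proof.
pose N := (Num.trunc s).+1.
have lim0 : (N.+1`!%:R * k.+2%:R^-1 : R) @[k --> \oo] --> (0 : R).
  by rewrite -(mulr0 N.+1`!%:R); apply: cvgMl_tmp; exact: cvg_inv_nat2.
apply: (squeeze_cvgr _ (cvg_cst 0) lim0); apply: nearW => k.
rewrite laguerre_weight_ge0/=; set y : R := k.+2%:R.
have y1 : 1 <= y by rewrite /y ler1n.
have y0 : 0 < y := lt_le_trans ltr01 y1.
rewrite /laguerre_weight expRN ler_pdivrMr ?expR_gt0//.
have yN : y `^ s <= y ^+ N.
  by rewrite -powR_mulrn ?(ltW y0)//; apply: ler_powR => //; exact/ltW/truncnS_gt.
apply: (le_trans yN).
have := expR_ge1Dxn N (ltW y0).
set f : R := N.+1`!%:R; have f0 : 0 < f by rewrite ltr0n fact_gt0.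
move=> h; have {h} : y ^+ N.+1 / f <= expR y by apply: le_trans h; rewrite lerDr.
rewrite ler_pdivrMr// => h; rewrite mulrAC ler_pdivlMr// -exprSr.
by rewrite mulrC.
Qed.

(** Integration by parts on the exhausting intervals: the boundary terms
    vanish in the limit and both integrals converge monotonically. *)
Lemma gamma_moment_rec (R : realType) (s : R) : 0 < s ->
  gamma_moment s = (s%:E * gamma_moment (s - 1))%E.
Proof.
move=> s0.
have lim :
    (\int[lebesgue_measure]_(t in @exhausting_itv R k) (laguerre_weight s t)%:E)%E
    @[k --> \oo] --> (s%:E * gamma_moment (s - 1))%E.
  under eq_cvg => k.
    rewrite /exhausting_itv laguerre_weight_ibp//; last first.
      by rewrite (@lt_le_trans _ _ 1) ?invf_lt1 ?ltr1n// ler1n.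
    over.
  rewrite -[(s%:E * gamma_moment (s - 1))%E]add0e.
  apply: cvgeD; first by rewrite fin_num_adde_defr.
    apply: cvg_EFin; first exact: nearW.
    rewrite -(subr0 0); apply: cvgB; first exact: laguerre_weight_cvg0.
    exact: laguerre_weight_cvgy.
  by apply: cvgeZl => //; exact: gamma_moment_cvg.
exact: (cvg_unique (@ereal_hausdorff R) (@gamma_moment_cvg R s) lim).
Qed.

Lemma gamma_moment_ge0 (R : realType) (s : R) : (0 <= gamma_moment s)%E.
Proof. by apply: integral_ge0 => t _; rewrite lee_fin laguerre_weight_ge0. Qed.

Lemma gamma_moment0 (R : realType) : gamma_moment (0 : R) = 1%E.
Proof.
rewrite /gamma_moment integral_itv_obnd_cbnd; last exact: measurable_laguerre_weight.
rewrite integral_mkcond -(@integral_exponential_pdf R 1)//.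
apply: eq_integral => t _; rewrite /exponential_pdf !patchE.
by case: ifP => // _; rewrite /laguerre_weight powRr0 mulN1r.
Qed.

Lemma gamma_moment_nat (R : realType) (k : nat) : gamma_moment (k%:R : R) = (k`!%:R)%:E.
Proof.
elim: k => [|k IH]; first exact: gamma_moment0.
by rewrite gamma_moment_rec// -natr1 addrK IH factS natrM natr1 EFinM.
Qed.

(** For an exponent s + 1 > 0 the power is at most 1 + t^N, and the integer
    moments are factorials; one step of the recursion then reaches s. *)
Lemma gamma_moment_lty (R : realType) (s : R) : -1 < s -> (gamma_moment s < +oo)%E.
Proof.
move=> s1.
have : (gamma_moment (s + 1) < +oo)%E.
  have s0 : 0 < s + 1 by lra.
  pose N := (Num.trunc (s + 1)).+1.
  apply: (@le_lt_trans _ _ (gamma_moment (0 : R) + gamma_moment (N%:R : R))%E); last first.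
    by rewrite gamma_moment0 gamma_moment_nat ltry.
  rewrite /gamma_moment -ge0_integralD//; last 4 first.
    by move=> t _; rewrite lee_fin laguerre_weight_ge0.
    exact: measurable_laguerre_weight.
    by move=> t _; rewrite lee_fin laguerre_weight_ge0.
    exact: measurable_laguerre_weight.
  apply: ge0_le_integral => //.
  - by move=> t _; rewrite lee_fin laguerre_weight_ge0.
  - exact: measurable_laguerre_weight.
  - by apply: emeasurable_funD; exact: measurable_laguerre_weight.
  move=> t; rewrite /= in_itv/= andbT => t0.
  rewrite -EFinD lee_fin /laguerre_weight -mulrDl ler_pM2r ?expR_gt0//.
  rewrite powRr0; have [t1|t1] := leP 1 t.
    apply: (@le_trans _ _ (t `^ N%:R)); last by rewrite lerDr.
    by apply: ler_powR => //; exact/ltW/truncnS_gt.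
  apply: (@le_trans _ _ 1); last by rewrite lerDl powR_ge0.
  by rewrite -[leRHS](powRr0 t); apply: ger_powR; rewrite ?t0 ltW.
rewrite gamma_moment_rec ?addrK; last by lra.
apply: contraTT; rewrite -!leNgt !leye_eq => /eqP ->.
by rewrite gt0_muley// lte_fin; lra.
Qed.

Lemma gamma_moment_gt0 (R : realType) (s : R) : -1 < s -> (0 < gamma_moment s)%E.
Proof.
move=> s1; pose c : R := 2^-1 * expR (- 2).
have c0 : 0 < c by rewrite mulr_gt0 ?invr_gt0 ?expR_gt0.
have sub12 : (`[1%R, 2%R] : set R) `<=` `]0%R, +oo[.
  by move=> t; rewrite /= !in_itv/= andbT => /andP[+ _]; exact: lt_le_trans.
apply: (@lt_le_trans _ _ (\int[lebesgue_measure]_(t in `[1%R, 2%R]) c%:E)%E).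
  rewrite integral_cst//= lebesgue_measure_itv/= lte_fin ltr1n -EFinB.
  by rewrite mule_gt0// lte_fin; lra.
apply: (@le_trans _ _
  (\int[lebesgue_measure]_(t in `[1%R, 2%R]) (laguerre_weight s t)%:E)%E); last first.
  apply: ge0_subset_integral => //; first exact: measurable_laguerre_weight.
  by move=> t _; rewrite lee_fin laguerre_weight_ge0.
apply: ge0_le_integral => //.
- by move=> t _; rewrite lee_fin ltW.
- exact: measurable_laguerre_weight.
move=> t; rewrite /= in_itv/= => /andP[t1 t2]; rewrite lee_fin.
apply: ler_pM; rewrite ?invr_ge0 ?expR_ge0 ?ler_expR ?lerN2//.
have t0 : 0 < t by exact: lt_le_trans t1.
apply: (@le_trans _ _ (t `^ (-1))); last by apply: ler_powR => //; exact: ltW.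
by rewrite powR_inv1 ?(ltW t0)// lef_pV2 ?posrE.
Qed.

Lemma integrable_laguerre_weight (R : realType) (s : R) : -1 < s ->
  lebesgue_measure.-integrable `]0%R, +oo[ (fun t : R => (laguerre_weight s t)%:E).
Proof.
move=> s1; apply/integrableP; split; first exact: measurable_laguerre_weight.
under eq_integral => t _ do
  rewrite abse_EFin ger0_norm ?laguerre_weight_ge0//.
exact: gamma_moment_lty.
Qed.

Lemma integral_laguerre_poly (R : realType) (s : R) (p : {poly R}) : -1 < s ->
  (\int[lebesgue_measure]_(t in `]0%R, +oo[) (laguerre_weight s t * p.[t])%:E)%E =
  (moment_functional (fun k => fine (gamma_moment (s + k%:R))) p)%:E.
Proof.
move=> s1.
have sk (k : nat) : -1 < s + k%:R by rewrite ltr_wpDr.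
transitivity (\int[lebesgue_measure]_(t in `]0%R, +oo[)
   (\sum_(i < size p) (p`_i)%:E * (laguerre_weight (s + i%:R) t)%:E))%E.
  apply: eq_integral => t; rewrite inE/= in_itv/= andbT => t0.
  rewrite horner_coef mulr_sumr -sumEFin; apply: eq_bigr => i _.
  rewrite -EFinM /laguerre_weight powRD ?(gt_eqF t0) ?implybT//.
  by rewrite powR_mulrn ?ltW//; congr EFin; ring.
rewrite integral_sum//=; last first.
  by move=> i; apply: integrableZl => //; exact: integrable_laguerre_weight.
rewrite /moment_functional -sumEFin; apply: eq_bigr => i _.
rewrite integralZl//; last exact: integrable_laguerre_weight.
by rewrite EFinM fineK// ge0_fin_numE ?gamma_moment_ge0// gamma_moment_lty.
Qed.

Lemma laguerre_norm_poly (R : realType) (s : R) (p : {poly R}) : -1 < s ->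
  laguerre_norm s (fun t => p.[t]) =
  (Num.sqrt (moment_functional (fun k => fine (gamma_moment (s + k%:R))) (p * p)))%:E.
Proof.
move=> s1; rewrite /laguerre_norm.
under eq_integral do rewrite real_normK ?num_real// expr2 -hornerM.
rewrite integral_laguerre_poly// poweR_EFin powR12_sqrt//.
rewrite -lee_fin -integral_laguerre_poly//; apply: integral_ge0 => t _.
by rewrite lee_fin mulr_ge0 ?laguerre_weight_ge0// hornerM -expr2 sqr_ge0.
Qed.

End GammaMoments.

(** * The Markov constant *)

Lemma fine_gamma_moment_rec (R : realType) (s : R) (k : nat) : -1 < s ->
  fine (gamma_moment (s + k.+1%:R)) = (k%:R + (s + 1)) * fine (gamma_moment (s + k%:R)).
Proof.
move=> s1; have k0 : 0 <= k%:R :> R by [].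
rewrite -natr1 addrA gamma_moment_rec ?addrK; last by lra.
rewrite fineM// ?ge0_fin_numE ?gamma_moment_ge0 ?gamma_moment_lty//; last by lra.
by rewrite /=; ring.
Qed.

Section Markov.
Variables (R : realType) (alpha : R) (n : nat).
Hypothesis alpha_gtN1 : -1 < alpha.
Let a : R := alpha + 1.
Let L : {scalar {poly R}} :=
  moment_functional (fun k => fine (gamma_moment (alpha + k%:R))).

Let a_gt0 : 0 < a. Proof. by rewrite -ltrBlDr sub0r. Qed.

Let L_ibp p : L ('X * p^`()) = L (('X - a%:P) * p).
Proof. by apply: moment_functional_ibp => k; exact: fine_gamma_moment_rec. Qed.

Let L1_gt0 : 0 < L 1.
Proof.
rewrite /L /= /moment_functional size_poly1 big_ord1 coef1 mul1r addr0.
by rewrite fine_gt0// gamma_moment_gt0 ?gamma_moment_lty.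
Qed.

Let L_ge0 (p : {poly R}) : 0 <= L (p * p).
Proof.
have [->|p0] := eqVneq p 0; first by rewrite mul0r linear0.
by rewrite ltW ?(laguerre_sqr_gt0 a_gt0 L_ibp).
Qed.

Lemma markov_ratio (p : {poly R}) : p != 0 ->
  (laguerre_norm alpha (fun t => p^`().[t]) / laguerre_norm alpha (fun t => p.[t]))%E =
  (Num.sqrt (L (p^`() * p^`()) / L (p * p)))%:E.
Proof.
move=> p0; rewrite !laguerre_norm_poly//.
have Lp0 := laguerre_sqr_gt0 a_gt0 L_ibp L1_gt0 p0.
by rewrite inver gt_eqF ?sqrtr_gt0// -EFinM sqrtrM ?L_ge0// sqrtrV// ltW.
Qed.

Let c := markov_const n alpha.

Lemma markov_const_ge0 : (0 <= c)%E.
Proof.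
apply: ereal_sup_ge; eexists.
  by exists (1 : {poly R}) => //=; split; [rewrite size_poly1|exact: oner_neq0].
by rewrite /= markov_ratio ?oner_neq0// lee_fin sqrtr_ge0.
Qed.

Lemma markov_const_le (B : R) : laguerre_trace3 a n <= B ^+ 3 -> 0 <= B ->
  (c <= (Num.sqrt B)%:E)%E.
Proof.
move=> tB B0; apply: ge_ereal_sup => _ [p [sz p0] <-].
have Lp0 := laguerre_sqr_gt0 a_gt0 L_ibp L1_gt0 p0.
rewrite markov_ratio// lee_fin ler_wsqrtr// ler_pdivrMr//.
rewrite -(@ler_pXn2r _ 3)// ?nnegrE ?L_ge0 ?mulr_ge0 ?(ltW Lp0)// exprMn.
apply: (le_trans (laguerre_deriv_cube_le a_gt0 L_ibp L1_gt0 sz)).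
by rewrite mulrC ler_pM2r// exprn_gt0.
Qed.

Lemma markov_const_ge (b : R) : c = b%:E ->
  laguerre_trace3 a n <= b ^+ 2 * laguerre_trace2 a n.
Proof.
move=> cb; apply: (laguerre_trace_le a_gt0 L_ibp L1_gt0) => p sz.
have b0 : 0 <= b by rewrite -lee_fin -cb markov_const_ge0.
have [->|p0] := eqVneq p 0; first by rewrite deriv0 !mul0r linear0 mulr0.
have Lp0 := laguerre_sqr_gt0 a_gt0 L_ibp L1_gt0 p0.
rewrite -ler_pdivrMr// -[leLHS]sqr_sqrtr; last by rewrite divr_ge0 ?L_ge0.
rewrite ler_sqr ?nnegrE ?sqrtr_ge0// -lee_fin -cb -markov_ratio//.
by apply: ereal_sup_ubound; exists p.
Qed.
End Markov.

Theorem theorem1 (R : realType) (alpha : R) (n : nat)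
    (halpha : -1 < alpha) (hn : (3 <= n)%N) :
  ((alpha + 1) / 6 < n%:R ->
    ((2 * (n%:R + 2 * alpha / 3) * (n%:R - (alpha + 1) / 6)
      / ((alpha + 1) * (alpha + 5)))%:E < (markov_const n alpha) ^+ 2)%E) /\
  ((markov_const n alpha) ^+ 2 <
    ((n%:R + 1) * (n%:R + 2 * (alpha + 1) / 5)
      / ((alpha + 1) * ((alpha + 3) * (alpha + 5)) `^ (3^-1)))%:E)%E.
Proof.
have a_gt0 : 0 < alpha + 1 by lra.
pose T3 := laguerre_trace3 (alpha + 1) n; pose T2 := laguerre_trace2 (alpha + 1) n.
have T3_ge0 : 0 <= T3.
  rewrite /T3 /laguerre_trace3; do 3![apply: sumr_ge0 => ? _].
  have H0 j : 0 <= laguerre_sqnorm_sum (alpha + 1) j.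
    by apply: sumr_ge0 => i _; rewrite ltW ?laguerre_sqnorm_gt0.
  by rewrite divr_ge0 ?mulr_ge0// ltW ?laguerre_sqnorm_gt0.
pose B := T3 `^ 3^-1.
have B3 : B ^+ 3 = T3 by rewrite -powR_mulrn ?powR_ge0// -powRrM mulVf// powRr1.
have cB : (markov_const n alpha <= (Num.sqrt B)%:E)%E.
  by apply: markov_const_le; rewrite ?B3 ?powR_ge0.
have [b cE] : exists b, markov_const n alpha = b%:E.
  exists (fine (markov_const n alpha)); rewrite fineK// ge0_fin_numE ?markov_const_ge0//.
  exact: le_lt_trans cB (ltry _).
have b0 : 0 <= b by rewrite -lee_fin -cE markov_const_ge0.
rewrite cE -EFin_expe !lte_fin; split => [_|].
  have T2_gt0 : 0 < T2 by rewrite laguerre_trace2_gt0// (leq_trans _ hn).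
  have := markov_const_ge halpha cE; rewrite -/T2 -/T3 => Tb.
  have := trace_ratio_gt a_gt0 hn; rewrite -/T2 -/T3 => lt_tr.
  rewrite ltr_pdivrMr; last by rewrite mulr_gt0//; lra.
  rewrite -(ltr_pM2r T2_gt0).
  have -> : 2 * (n%:R + 2 * alpha / 3) * (n%:R - (alpha + 1) / 6) * T2 =
     2 * (n%:R + 2 * (alpha + 1 - 1) / 3) * (n%:R - (alpha + 1) / 6) * T2 by ring.
  apply: (lt_le_trans lt_tr).
  have -> : b ^+ 2 * ((alpha + 1) * (alpha + 5)) * T2 =
     (alpha + 1) * (alpha + 1 + 4) * (b ^+ 2 * T2) by ring.
  by rewrite ler_wpM2l// mulr_ge0//; lra.
have bB : b ^+ 2 <= B.
  by rewrite -[leRHS]sqr_sqrtr ?powR_ge0// ler_sqr ?nnegrE ?sqrtr_ge0// -lee_fin -cE.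
apply: (le_lt_trans bB).
pose r := ((alpha + 3) * (alpha + 5)) `^ 3^-1.
have r_gt0 : 0 < r by rewrite powR_gt0// mulr_gt0//; lra.
have r3 : r ^+ 3 = (alpha + 3) * (alpha + 5).
  by rewrite -powR_mulrn ?powR_ge0// -powRrM mulVf// powRr1// mulr_ge0//; lra.
rewrite ltr_pdivlMr ?mulr_gt0// -(@ltr_pXn2r _ 3)// ?nnegrE; last 2 first.
- by rewrite !mulr_ge0 ?powR_ge0// ltW.
- have n0 : 0 <= n%:R :> R by [].
  by rewrite mulr_ge0//; lra.
rewrite -/r exprMn B3 exprMn r3.
apply: le_lt_trans (trace3_lt a_gt0 hn); rewrite -/T3.
by rewrite le_eqVlt; apply/orP; left; apply/eqP; ring.
Qed.
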